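(* For any $\delta\in(0,1)$ and any integers $0=k_0<k_1<\dots<k_t<n\le m$, there is a matrix $\mathbf A\in\mathbb R^{m\times n}$ such that for every $i\in\{1,\dots,t\}$ and every subset $S\subseteq\{1,\dots,n\}$ with $|S|=k_i$, \[ \frac{\mathrm{Er}_{\mathbf A}(S)}{\mathrm{OPT}_{k_i}}\ge(1-\delta)(k_i-k_{i-1}). \]
   Context: For $\mathbf A\in\mathbb R^{m\times n}$ with columns $\mathbf a_1,\dots,\mathbf a_n$ and $S\subseteq\{1,\dots,n\}$, $\mathbf P_S$ denotes the orthogonal projection onto $\mathrm{span}\{\mathbf a_i:i\in S\}$ and $\mathrm{Er}_{\mathbf A}(S)=\|\mathbf A-\mathbf P_S\mathbf A\|_F^2$. $\mathrm{OPT}_k=\min_{\mathrm{rank}(\mathbf B)=k}\|\mathbf A-\mathbf B\|_F^2$ (Frobenius norm). *)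

(* Defs.v *)
From HB Require Import structures.
From mathcomp Require Import all_boot all_order all_algebra.
From mathcomp Require Import boolp classical_sets reals.
Set Implicit Arguments. Unset Strict Implicit. Unset Printing Implicit Defensive.
Import Order.TTheory GRing.Theory Num.Theory.
Local Open Scope classical_set_scope.
Local Open Scope ring_scope.

Definition frob2 {R : realType} {m n : nat} (M : 'M[R]_(m, n)) : R :=
  \sum_(i < m) \sum_(j < n) M i j ^+ 2.

(* A with the columns outside S set to zero: its column space is
   span{ a_i : i in S }. *)
Definition colsel {R : realType} {m n : nat} (A : 'M[R]_(m, n)) (S : {set 'I_n})
  : 'M[R]_(m, n) := \matrix_(i, j) (if j \in S then A i j else 0).

(* P is the orthogonal projection onto span{ a_i : i in S }:
   symmetric, idempotent, with range (= row space of P, since P = P^T)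
   equal to the span of the columns a_i, i in S (= row space of (colsel A S)^T). *)
Definition is_orth_proj_cols {R : realType} {m n : nat} (A : 'M[R]_(m, n))
  (S : {set 'I_n}) (P : 'M[R]_m) : Prop :=
  P^T = P /\ P *m P = P /\ (P == (colsel A S)^T)%MS.

Definition projS {R : realType} {m n : nat} (A : 'M[R]_(m, n)) (S : {set 'I_n})
  : 'M[R]_m := xget 0 (is_orth_proj_cols A S).

Definition Er {R : realType} {m n : nat} (A : 'M[R]_(m, n)) (S : {set 'I_n}) : R :=
  frob2 (A - projS A S *m A).

(* OPT_k = min_{rank B = k} || A - B ||_F^2 (the minimum is attained; we
   write it as the infimum). *)
Definition OPT {R : realType} {m n : nat} (A : 'M[R]_(m, n)) (k : nat) : R :=
  inf [set frob2 (A - B) | B in [set B : 'M[R]_(m, n) | \rank B = k]].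

(* Main.v *)
Require Import Defs.
From HB Require Import structures.
From mathcomp Require Import all_boot all_order all_algebra.
From mathcomp Require Import boolp classical_sets reals.
From mathcomp Require Import ring lra.
Import Order.TTheory GRing.Theory Num.Theory.
Local Open Scope ring_scope.

(** Let [V] be the invertible matrix with, for each block
    [B = (k_(i-1), k_i]] of indices, rows [e_r - e_max B] for [r] in [B] other
    than [max B] and the row [1_B] for [r = max B = k_i]. Put [A = D V] with
    [D = diag(q^r)] and [q] tiny; up to small perturbations the columns of a
    block span a flat simplex. Dropping the rows [r >= k_i] of [D] leaves
    rank [k_i] and an error of about [q^(2 k_i) |B|], which bounds [OPT].
    A set [S] of [k_i] columns misses some column [j <= k_i]; row [j] of
    [A^-1] annihilates the columns in [S] and has squared norm at most about
    [q^(-2 k_i) / |B|^2], so by Cauchy-Schwarz the error of [S] is at least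
    about [q^(2 k_i) |B|^2]. The ratio is thus about [|B| = k_i - k_(i-1)]. *)

Lemma cauchy_schwarz_sum {R : realType} (I : finType) (a b : I -> R) :
  (\sum_i a i * b i) ^+ 2 <= (\sum_i a i ^+ 2) * (\sum_i b i ^+ 2).
Proof.
set p := \sum_i a i * b i; set x := \sum_i a i ^+ 2; set y := \sum_i b i ^+ 2.
have quad (s u : R) : 0 <= s ^+ 2 * x - 2 * s * u * p + u ^+ 2 * y.
  suff -> : s ^+ 2 * x - 2 * s * u * p + u ^+ 2 * y
            = \sum_i (s * a i - u * b i) ^+ 2.
    by apply: sumr_ge0 => i _; apply: sqr_ge0.
  rewrite /x /y /p !mulr_sumr -sumrN -!big_split /=.
  by apply: eq_bigr => i _; ring.
have y0 : 0 <= y by apply: sumr_ge0 => i _; apply: sqr_ge0.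
have [x_gt0|x_le0] := ltP 0 x.
  rewrite -subr_ge0 -(pmulr_rge0 _ x_gt0); apply: le_trans (quad p x) _.
  by rewrite le_eqVlt; apply/orP; left; apply/eqP; ring.
have x_eq0 : x = 0.
  by apply/le_anti; rewrite x_le0 sumr_ge0 // => i _; apply: sqr_ge0.
rewrite x_eq0 mul0r; have [->|p0] := eqVneq p 0; first by rewrite expr0n.
have := quad ((y + 1) / p) 1; rewrite x_eq0 mulr0 mulr1 add0r expr1n mul1r.
by rewrite -mulrA divfK //; lra.
Qed.

Lemma frob2_ge0 {R : realType} {m n : nat} (M : 'M[R]_(m, n)) : 0 <= frob2 M.
Proof. by do 2![apply: sumr_ge0 => ? _]; apply: sqr_ge0. Qed.

Lemma frob2_gt0 {R : realType} {m n : nat} (M : 'M[R]_(m, n)) :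
  M != 0 -> 0 < frob2 M.
Proof.
move=> M0; rewrite lt_def frob2_ge0 andbT; apply: contra M0 => /eqP M0.
have rows0 i : \sum_j M i j ^+ 2 = 0.
  apply/eqP; move/eqP: M0; rewrite psumr_eq0 => [/allP/(_ i)|? _].
    by rewrite mem_index_enum => /(_ isT).
  by apply: sumr_ge0 => ? _; apply: sqr_ge0.
apply/eqP/matrixP => i j; rewrite mxE; apply/eqP; rewrite -sqrf_eq0.
have /eqP := rows0 i; rewrite psumr_eq0 => [/allP/(_ j)|? _].
  by rewrite mem_index_enum => /(_ isT).
exact: sqr_ge0.
Qed.

Lemma frob2_mul {R : realType} {m n p : nat}
  (X : 'M[R]_(m, n)) (Y : 'M[R]_(n, p)) :
  frob2 (X *m Y) <= frob2 X * frob2 Y.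
Proof.
rewrite /frob2 mulr_suml ler_sum // => i _.
rewrite [X in _ * X]exchange_big mulr_sumr ler_sum // => j _.
by rewrite mxE cauchy_schwarz_sum.
Qed.

Lemma frob2_tr {R : realType} {m n : nat} (M : 'M[R]_(m, n)) :
  frob2 M = \tr (M *m M^T).
Proof.
apply: eq_bigr => i _; rewrite !mxE; apply: eq_bigr => j _.
by rewrite !mxE expr2.
Qed.

Lemma pid_mx_isometry {R : realType} {m n : nat} : (n <= m)%N ->
  @pid_mx R n m n *m @pid_mx R m n n = 1%:M /\
  (@pid_mx R n m n)^T = @pid_mx R m n n.
Proof.
move=> nm; rewrite tr_pid_mx mul_pid_mx minnn (minn_idPr nm).
by split=> //; apply: pid_mx_1.
Qed.

Lemma frob2_mulr_pid {R : realType} {m n p : nat} (X : 'M[R]_(p, n)) :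
  (n <= m)%N -> frob2 (X *m @pid_mx R n m n) = frob2 X.
Proof.
move=> /(@pid_mx_isometry R)[pK pT]; rewrite !frob2_tr trmx_mul pT.
by rewrite mulmxA -[X *m _ *m _]mulmxA pK mulmx1.
Qed.

Lemma frob2_mull_pid {R : realType} {m n p : nat} (X : 'M[R]_(n, p)) :
  (n <= m)%N -> frob2 (@pid_mx R m n n *m X) = frob2 X.
Proof.
move=> nm; have [pK _] := @pid_mx_isometry R _ _ nm.
rewrite !frob2_tr trmx_mul tr_pid_mx mxtrace_mulC.
by rewrite mulmxA -[X^T *m _ *m _]mulmxA pK mulmx1 mxtrace_mulC.
Qed.

Lemma sum_ord_le {R : realType} {n : nat} (P : pred 'I_n) (F : 'I_n -> R)
  (c : R) :
  0 <= c -> (forall i, P i -> F i <= c) -> \sum_(i | P i) F i <= n%:R * c.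
Proof.
move=> c0 Fc; rewrite big_mkcond /= -[n in n%:R]card_ord mulr_natl -sumr_const.
by apply: ler_sum => i _; case: ifP => // /Fc.
Qed.

(* This also holds for the default value [0] of [xget], so the existence of the
   orthogonal projection never has to be proved. *)
Lemma projS_sub {R : realType} {m n : nat} (A : 'M[R]_(m, n)) (S : {set 'I_n}) :
  exists X, projS A S = colsel A S *m X.
Proof.
rewrite /projS; case: xgetP => [P _ [PT [_ /andP[/submxP[X PX] _]]]|_].
  by exists X^T; rewrite -PT PX trmx_mul trmxK.
by exists 0; rewrite mulmx0.
Qed.

Lemma Er_ge {R : realType} {m n : nat} (A : 'M[R]_(m, n)) (L : 'M[R]_(n, m))
  (S : {set 'I_n}) (j : 'I_n) :
  L *m A = 1%:M -> j \notin S -> 1 <= frob2 (row j L) * Er A S.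
Proof.
move=> LA jS; apply: le_trans (frob2_mul _ _).
have -> : row j L *m (A - projS A S *m A) = delta_mx 0 j.
  have [X ->] := projS_sub A S.
  have L0 : row j L *m colsel A S = 0.
    apply/matrixP => i s; rewrite !mxE.
    have [sS|sS] := boolP (s \in S); last first.
      by rewrite big1 // => u _; rewrite !mxE (negPf sS) mulr0.
    transitivity ((L *m A) j s).
      by rewrite !mxE; apply: eq_bigr => u _; rewrite !mxE sS.
    rewrite LA mxE; case: eqP => // js.
    by rewrite js sS in jS.
  by rewrite mulmxBr 2!mulmxA L0 !mul0mx subr0 -row_mul LA row1.
rewrite /frob2 big_ord1 (bigD1 j) //= mxE !eqxx /= expr1n lerDl.
by apply: sumr_ge0 => ? _; apply: sqr_ge0.
Qed.

Lemma frob2_sub_ge {R : realType} {m n : nat} (A B : 'M[R]_(m, n))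
  (L : 'M[R]_(n, m)) :
  L *m A = 1%:M -> (\rank B < n)%N -> 1 <= frob2 L * frob2 (A - B).
Proof.
move=> LA rB; set X := cokermx B.
have X0 : 0 < frob2 X.
  by apply: frob2_gt0; rewrite -mxrank_eq0 mxrank_coker subn_eq0 -ltnNge.
rewrite -(ler_pM2r X0) mul1r.
have {1}-> : X = L *m (A - B) *m X.
  by rewrite mulmxBr mulmxBl LA mul1mx -mulmxA mulmx_coker mulmx0 subr0.
apply: le_trans (frob2_mul _ _) _.
by rewrite ler_pM2r // frob2_mul.
Qed.

Lemma OPT_le {R : realType} {m n : nat} (A B : 'M[R]_(m, n)) :
  OPT A (\rank B) <= frob2 (A - B).
Proof.
apply: ge_inf; last by exists B.
by exists 0 => _ [C _ <-]; apply: frob2_ge0.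
Qed.

Lemma OPT_gt0 {R : realType} {m n k : nat} (A : 'M[R]_(m, n))
  (L : 'M[R]_(n, m)) :
  L *m A = 1%:M -> (k < n)%N -> (n <= m)%N -> 0 < OPT A k.
Proof.
move=> LA kn nm.
have L0 : 0 < frob2 L.
  apply: frob2_gt0; apply/eqP => L0; move: LA.
  rewrite L0 mul0mx => /matrixP/(_ (Ordinal kn) (Ordinal kn)) /eqP.
  by rewrite !mxE eqxx eq_sym oner_eq0.
apply: (@lt_le_trans _ _ (frob2 L)^-1); first by rewrite invr_gt0.
apply: lb_le_inf.
  exists (frob2 (A - pid_mx k)), (pid_mx k) => //=.
  by rewrite rank_pid_mx // ltnW // (leq_trans kn).
move=> _ [B /= rB <-]; rewrite -div1r ler_pdivrMr // mulrC.
by apply: frob2_sub_ge => //; rewrite rB.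
Qed.

Definition blk {n : nat} (e : 'I_n -> 'I_n) (r : 'I_n) : {set 'I_n} :=
  [set j | e j == r].

(* [e] sends each index to the last index of its block. *)
Definition simplex_mx (R : realType) {n : nat} (e : 'I_n -> 'I_n) : 'M[R]_n :=
  \matrix_(r, j) (if e r == r then (e j == r)%:R
                  else (j == r)%:R - (j == e r)%:R).

Definition simplex_inv (R : realType) {n : nat} (e : 'I_n -> 'I_n) : 'M[R]_n :=
  \matrix_(j, r) (if e r == r then (e j == r)%:R / #|blk e r|%:R
                  else (j == r)%:R - (e j == e r)%:R / #|blk e (e r)|%:R).

Section Simplex.
Variables (R : realType) (n : nat) (e : 'I_n -> 'I_n).
Hypothesis eK : forall j, e (e j) = e j.

Lemma card_blk_gt0 (r : 'I_n) : (0 < #|blk e (e r)|)%N.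
Proof. by apply/card_gt0P; exists r; rewrite inE. Qed.

Lemma sum_blk (r : 'I_n) (F : 'I_n -> R) :
  \sum_j (e j == r)%:R * F j = \sum_(j in blk e r) F j.
Proof.
rewrite [RHS]big_mkcond /=; apply: eq_bigr => j _.
by rewrite inE; case: eqP; rewrite ?mul1r ?mul0r.
Qed.

Lemma simplex_mxK : simplex_mx R e *m simplex_inv R e = 1%:M.
Proof.
apply/matrixP => r s; rewrite !mxE.
have l0 u : #|blk e (e u)|%:R != 0 :> R by rewrite pnatr_eq0 -lt0n card_blk_gt0.
have [er|er] := eqVneq (e r) r.
  under eq_bigr => j _ do rewrite !mxE er eqxx.
  rewrite sum_blk; have [es|es] := eqVneq (e s) s.
    transitivity (\sum_(j in blk e r) (r == s)%:R / #|blk e s|%:R : R).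
      by apply: eq_bigr => j; rewrite inE => /eqP ->.
    rewrite sumr_const -[_ *+ #|_|]mulr_natr; have [->|_] := eqVneq r s.
      by rewrite mul1r mulVf // -es.
    by rewrite !mul0r.
  transitivity (\sum_(j in blk e r) ((j == s)%:R
                  - (r == e s)%:R / #|blk e (e s)|%:R) : R).
    by apply: eq_bigr => j; rewrite inE => /eqP ->.
  rewrite sumrB sumr_const -[_ *+ #|_|]mulr_natr.
  have -> : \sum_(j in blk e r) (j == s)%:R = (e s == r)%:R :> R.
    rewrite -sum_blk (bigD1 s) //= eqxx mulr1 big1 ?addr0 // => j /negPf ->.
    by rewrite mulr0.
  have [->|_] := eqVneq r (e s).
    by rewrite mul1r mulVf // (negPf es) subrr.
  rewrite !mul0r subr0; case: eqP => // rs.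
  by rewrite -rs er eqxx in es.
under eq_bigr => j _ do rewrite mxE (negPf er) mulrBl.
rewrite sumrB.
have pick (u : 'I_n) (F : 'I_n -> R) : \sum_j (j == u)%:R * F j = F u.
  rewrite (bigD1 u) //= eqxx mul1r big1 ?addr0 // => j /negPf ->.
  by rewrite mul0r.
rewrite !pick !mxE !eK; have [es|es] := eqVneq (e s) s.
  have [rs|_] := eqVneq r s; last by rewrite subrr.
  by rewrite rs es eqxx in er.
have [ers|ers] := eqVneq (e r) s; first by rewrite -ers eK eqxx in es.
by rewrite mulr0n; ring.
Qed.

Lemma simplex_mx_sqr_le1 r j : simplex_mx R e r j ^+ 2 <= 1.
Proof.
rewrite mxE; have [er|er] := eqVneq (e r) r.
  by case: (_ == _); rewrite ?expr1n ?expr0n.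
by case: (_ == _); case: (_ == _);
  rewrite ?subrr ?subr0 ?sub0r ?sqrrN ?expr1n ?expr0n.
Qed.

Lemma simplex_inv_sqr_le1 j r : simplex_inv R e j r ^+ 2 <= 1.
Proof.
have inv_card u (x : R) : x = (e j == e u)%:R / #|blk e (e u)|%:R -> 0 <= x <= 1.
  have l0 : 0 < #|blk e (e u)|%:R :> R by rewrite ltr0n card_blk_gt0.
  move=> ->; rewrite divr_ge0 //= ler_pdivrMr // mul1r ler_nat.
  by apply: leq_trans (leq_b1 _) (card_blk_gt0 u).
rewrite mxE; have := inv_card r _ erefl; have [er|er] := eqVneq (e r) r.
  by rewrite er => h; nra.
by set x := _ / _ => h; case: (j == r); rewrite ?mulr1n ?mulr0n; nra.
Qed.

Lemma simplex_inv_supp j r : e r != e j -> simplex_inv R e j r = 0.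
Proof.
move=> rj; have jr : j != r by apply: contraNneq rj => ->.
rewrite mxE [e j == e r]eq_sym (negPf rj) (negPf jr) !mul0r subr0.
by case: eqP => // er; rewrite -{1}er eq_sym (negPf rj) mul0r.
Qed.

End Simplex.

Definition scaled_mx {R : realType} (m : nat) {n : nat} (e : 'I_n -> 'I_n)
  (q : R) : 'M[R]_(m, n) :=
  pid_mx n *m (diag_mx (\row_r q ^+ r) *m simplex_mx R e).

Definition scaled_inv {R : realType} (m : nat) {n : nat} (e : 'I_n -> 'I_n)
  (q : R) : 'M[R]_(n, m) :=
  simplex_inv R e *m diag_mx (\row_r q ^- r) *m pid_mx n.

Section Scaled.
Variables (R : realType) (m n : nat) (e : 'I_n -> 'I_n) (q : R).
Hypotheses (eK : forall j, e (e j) = e j) (le_e : forall j : 'I_n, (j <= e j)%N).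
Hypotheses (nm : (n <= m)%N) (q0 : 0 < q) (q1 : q <= 1).

Lemma diag_scaleK :
  diag_mx (\row_r q ^- r) *m diag_mx (\row_r q ^+ r) = 1%:M :> 'M[R]_n.
Proof.
rewrite mulmx_diag -diag_const_mx; congr diag_mx; apply/rowP => r.
by rewrite !mxE mulVf // expf_neq0 // gt_eqF.
Qed.

Lemma scaled_mxK : scaled_inv m e q *m scaled_mx m e q = 1%:M.
Proof.
have [pK _] := @pid_mx_isometry R _ _ nm.
rewrite /scaled_inv /scaled_mx -mulmxA [pid_mx n *m _]mulmxA pK mul1mx.
rewrite -mulmxA [X in _ *m X]mulmxA diag_scaleK mul1mx.
by apply: mulmx1C; apply: simplex_mxK.
Qed.

Lemma scale_sqr_lt (a b : nat) :
  (a < b)%N -> (q ^+ b) ^+ 2 <= (q ^+ a) ^+ 2 * q.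
Proof.
move=> ab; set p := q ^+ (b - a.+1).
have -> : (q ^+ b) ^+ 2 = (q ^+ a) ^+ 2 * q * (q * p ^+ 2).
  by rewrite -(subnKC ab) exprD [q ^+ a.+1]exprS -/p; ring.
apply: ler_piMr; first by rewrite mulr_ge0 ?sqr_ge0 // ltW.
by rewrite mulr_ile1 ?sqr_ge0 ?exprn_ile1 ?exprn_ge0 // ltW.
Qed.

Lemma frob2_row_scaled_inv (k j : 'I_n) :
  e k = k -> (e j <= k)%N ->
  frob2 (row j (scaled_inv m e q)) * (q ^+ k) ^+ 2
    <= (#|blk e k|%:R ^+ 2)^-1 + n%:R * q.
Proof.
move=> ek ejk; rewrite row_mul frob2_mulr_pid // mul_mx_diag /frob2 big_ord1.
rewrite mulr_suml (eq_bigr (fun r : 'I_n =>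
  simplex_inv R e j r ^+ 2 * ((q ^+ r) ^- 2 * (q ^+ k) ^+ 2))); last first.
  by move=> r _; rewrite 2!mxE [(\row__ _) _ _]mxE exprMn exprVn -mulrA.
rewrite (bigD1 k) //= lerD //.
  rewrite mulVf ?mulr1; last by rewrite !expf_neq0 // gt_eqF.
  rewrite mxE ek eqxx exprMn exprVn ler_piMl ?invr_ge0 ?sqr_ge0 //.
  by case: (_ == _); rewrite ?expr1n ?expr0n.
apply: sum_ord_le => [|r rk]; first exact: ltW.
have [kr|kr] := ltnP k r.
  rewrite simplex_inv_supp // ?expr0n ?mul0r ?ltW //.
  by apply: contraTneq (leq_trans kr (le_e r)) => ->; rewrite -leqNgt.
have {rk}rk : (r < k)%N by rewrite ltn_neqAle rk.
apply: (@le_trans _ _ ((q ^+ r) ^- 2 * (q ^+ k) ^+ 2)).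
  by rewrite ler_piMl ?simplex_inv_sqr_le1 // mulr_ge0 ?invr_ge0 ?sqr_ge0.
rewrite mulrC ler_pdivrMr ?exprn_gt0 // mulrC.
exact: scale_sqr_lt.
Qed.

Lemma OPT_scaled_le (k : 'I_n) :
  e k = k ->
  OPT (scaled_mx m e q) k
    <= (q ^+ k) ^+ 2 * (#|blk e k|%:R + n%:R * (n%:R * q)).
Proof.
move=> ek; set Z := diag_mx (\row_r q ^+ r) *m simplex_mx R e.
have Zfree : row_free Z.
  rewrite row_free_unit; have [] := @mulmx1_unit _ _ Z
    (simplex_inv R e *m diag_mx (\row_r q ^- r)); last by [].
  rewrite /Z mulmxA -[_ *m _ *m simplex_inv R e]mulmxA simplex_mxK // mulmx1.
  by apply: mulmx1C; apply: diag_scaleK.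
have kn : (k <= n)%N by apply: ltnW.
have rB : \rank (@pid_mx R m n k *m Z) = k.
  by rewrite mxrankMfree // rank_pid_mx // (leq_trans kn).
have := OPT_le (scaled_mx m e q) (pid_mx k *m Z); rewrite rB.
move=> /le_trans; apply.
have -> : scaled_mx m e q - pid_mx k *m Z
    = @pid_mx R m n n *m (diag_mx (\row_r ((k <= r)%:R * q ^+ r))
                         *m simplex_mx R e).
  have -> : @pid_mx R m n k = @pid_mx R m n n *m pid_mx k.
    by rewrite mul_pid_mx !(minn_idPr kn).
  rewrite /scaled_mx -/Z -mulmxA -mulmxBr -{1}[Z]mul1mx -mulmxBl.
  congr (_ *m _); rewrite /Z mulmxA; congr (_ *m _); apply/matrixP => a b.
  rewrite mul_mx_diag !mxE -[(a == b :> nat)]/(a == b); have [->|_] := eqVneq a b; last first.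
    by rewrite /= !mulr0n subrr mul0r.
  by rewrite /= mulr1n; case: ltnP; rewrite ?subr0 ?subrr.
rewrite frob2_mull_pid // mul_diag_mx /frob2 (bigD1 k) //= mulrDr lerD //.
  rewrite -sum1_card natr_sum mulr_sumr [leRHS]big_mkcond /= ler_sum // => j _.
  rewrite !mxE ek eqxx leqnn mul1r inE; case: (_ == _).
    by rewrite mulr1 mulr1.
  by rewrite mulr0 expr0n.
rewrite mulrCA; apply: sum_ord_le => [|r rk].
  by rewrite mulr_ge0 ?sqr_ge0 // mulr_ge0 // ltW.
rewrite mulrCA; apply: sum_ord_le => [|j _].
  by rewrite mulr_ge0 ?sqr_ge0 // ltW.
rewrite 2!mxE exprMn; apply: (@le_trans _ _ (((k <= r)%:R * q ^+ r) ^+ 2)).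
  by rewrite ler_piMr ?sqr_ge0 ?simplex_mx_sqr_le1.
case: leqP => [kr|_]; last by rewrite mul0r expr0n mulr_ge0 ?sqr_ge0 ?ltW.
by rewrite mul1r scale_sqr_lt // ltn_neqAle eq_sym rk.
Qed.
End Scaled.

Lemma block_ratio (R : realType) (m n : nat) (e : 'I_n -> 'I_n) (delta : R) :
  (forall j, e (e j) = e j) -> (forall j : 'I_n, (j <= e j)%N) ->
  (n <= m)%N -> 0 < delta < 1 ->
  exists A : 'M[R]_(m, n), forall r : 'I_n, e r = r ->
    (forall j : 'I_n, (j <= r)%N -> (e j <= r)%N) ->
    forall S : {set 'I_n}, #|S| = r ->
      (1 - delta) * #|blk e r|%:R <= Er A S / OPT A r.
Proof.
move=> eK le_e nm /andP[d0 d1]; set N : R := n.+1%:R.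
have N1 : 1 <= N by rewrite ler1n.
pose q := delta / (4 * N ^+ 3).
have N3 : 1 <= N ^+ 3 by apply: exprn_ege1.
have q0 : 0 < q by apply: divr_gt0 => //; lra.
have qN : N ^+ 3 * q = delta / 4 by rewrite /q; field; lra.
have q1 : q <= 1 by nra.
exists (scaled_mx m e q) => r er bound S cS.
have LA := @scaled_mxK R m n e q eK nm q0.
have [j jr jS] : exists2 j : 'I_n, (j <= r)%N & j \notin S.
    have /fintype.subsetPn[j] : ~~ ([set j : 'I_n | j <= r]%N \subset S).
      apply/negP => /subset_leq_card; rewrite cS leqNgt => /negP; apply.
      have inj : injective (widen_ord (ltn_ord r)).
        by move=> u v /(congr1 val) /= /val_inj.
      rewrite -[leqLHS]card_ord -(card_imset _ inj); apply: subset_leq_card.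
      by apply/fintype.subsetP => _ /imsetP[u _ ->]; rewrite inE /= -ltnS.
    by rewrite inE => jr jS; exists j.
have OPT0 := OPT_gt0 _ _ LA (ltn_ord r) nm.
have := Er_ge _ _ S j LA jS.
have := @frob2_row_scaled_inv R m n e q le_e nm q0 q1 r j er (bound j jr).
have := @OPT_scaled_le R m n e q eK nm q0 q1 r er.
rewrite ler_pdivlMr //.
set x := (q ^+ r) ^+ 2; set f := frob2 _; set l := #|blk e r|%:R.
set E := Er _ _; set O := OPT _ _.
have x0 : 0 < x by rewrite !exprn_gt0.
have l1 : 1 <= l by rewrite ler1n -er card_blk_gt0.
have lN : l <= N by rewrite ler_nat (leq_trans (max_card _)) // card_ord.
have nN : n%:R <= N by rewrite ler_nat leqnSn.
have n0 : 0 <= n%:R :> R by apply: ler0n.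
set y := delta / 4 in qN.
have y0 : 0 < y by rewrite divr_gt0.
move=> O_le f_le fE.
have O_le' : O <= x * (l * (1 + y)).
  apply: le_trans O_le _; rewrite ler_pM2l // mulrDr mulr1 lerD2l.
  apply: (@le_trans _ _ y); last by rewrite ler_peMl // ltW.
  rewrite -qN mulrA ler_pM2r // -expr2; apply: (@le_trans _ _ (N ^+ 2)).
    by apply: lerXn2r; rewrite ?nnegrE // (le_trans n0 nN).
  by rewrite ler_weXn2l.
have l20 : 0 < l ^+ 2 by rewrite exprn_gt0 // (lt_le_trans ltr01).
have f_le' : f * x * l ^+ 2 <= 1 + y.
  rewrite -ler_pdivlMr //; apply: le_trans f_le _.
  rewrite mulrDl mul1r lerD2l ler_pdivlMr // -qN mulrAC ler_pM2r //.
  by rewrite [N ^+ 3]exprS ler_pM ?sqr_ge0 // lerXn2r // nnegrE; lra.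
have f0 : 0 < f.
  rewrite lt_def frob2_ge0 andbT; apply: contraTneq fE => ->.
  by rewrite mul0r -ltNge ltr01.
rewrite -(ler_pM2l f0); apply: le_trans fE.
apply: (@le_trans _ _ (f * ((1 - delta) * l * (x * (l * (1 + y)))))).
  rewrite ler_pM2l // ler_wpM2l // mulr_ge0 //; lra.
rewrite [leLHS](_ : _ = (f * x * l ^+ 2) * ((1 - delta) * (1 + y))); last by ring.
apply: (@le_trans _ _ ((1 + y) * ((1 - delta) * (1 + y)))).
  by apply: ler_wpM2r => //; apply: mulr_ge0; lra.
rewrite /y; nra.
Qed.

(* [e j] is the least [x >= j] that is some [k i] or exceeds [k t], so the
   indices beyond [k t] form blocks of size one. *)
Lemma next_in_range (n t : nat) (k : nat -> nat) :
  (forall i, (i < t)%N -> (k i < k i.+1)%N) -> (k t < n)%N ->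
  exists e : 'I_n -> 'I_n,
    [/\ forall j, e (e j) = e j, forall j : 'I_n, (j <= e j)%N,
       forall i (j : 'I_n), (i <= t)%N -> (j <= k i)%N -> (e j <= k i)%N
     & forall i (j : 'I_n), (i < t)%N -> (k i < j <= k i.+1)%N ->
       e j = k i.+1 :> nat].
Proof.
move=> kS ktn.
have kmono a b : (a < b)%N -> (b <= t)%N -> (k a < k b)%N.
  elim: b => // b IHb; rewrite ltnS leq_eqVlt => /orP[/eqP->|ab] bt.
    exact: kS.
  by apply: ltn_trans (kS _ bt); apply: IHb => //; apply: ltnW.
have kle a b : (a <= b)%N -> (b <= t)%N -> (k a <= k b)%N.
  by rewrite leq_eqVlt => /orP[/eqP->//|ab] bt; apply/ltnW/kmono.
pose T (x : 'I_n) := (k t < x)%N || [exists i : 'I_t.+1, k i == x].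
have /choice[e eP] (j : 'I_n) : exists y : 'I_n,
    [/\ (j <= y)%N, T y & forall x : 'I_n, (j <= x)%N -> T x -> (y <= x)%N].
  have [x0 Px0] : exists x : 'I_n, (j <= x)%N && T x.
    have [jt|tj] := leqP j (k t); last by exists j; rewrite leqnn /T tj.
    exists (Ordinal ktn); rewrite jt /T; apply/orP; right.
    by apply/existsP; exists ord_max.
  case: (@arg_minnP _ x0 (fun x => (j <= x)%N && T x) (@nat_of_ord n) Px0) => y /andP[jy Ty] ymin.
  by exists y; split=> // x jx Tx; apply: ymin; rewrite jx.
have Tk i (kn : (k i < n)%N) : (i <= t)%N -> T (Ordinal kn).
  by move=> it; apply/orP; right; apply/existsP; exists (Ordinal (it : i < t.+1)%N).
have kn i : (i <= t)%N -> (k i < n)%N.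
  by move=> it; apply: leq_ltn_trans ktn; apply: kle.
exists e; split=> [j|j|i j it jk|i j it /andP[kj jk]].
- have [_ Tj _] := eP j; have [le1 _ /(_ _ (leqnn _) Tj)] := eP (e j).
  by move=> le2; apply/val_inj/anti_leq; rewrite le2.
- by have [] := eP j.
- by have [_ _ /(_ (Ordinal (kn i it)) jk)] := eP j; apply; apply: Tk.
have [je Te /(_ (Ordinal (kn _ it)) jk (Tk _ _ it)) /= ek] := eP j.
apply/eqP; rewrite eqn_leq ek /=; case/orP: Te => [te|/existsP[a /eqP ka]].
  by apply: leq_trans (ltnW te); apply: kle.
have [ia|ai] := ltnP i a; first by rewrite -ka kle // -ltnS.
have : (k a <= k i)%N by apply: kle => //; apply: ltnW.
by rewrite ka leqNgt (leq_trans kj je).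
Qed.

Theorem theorem3 (R : realType) (delta : R) (m n t : nat) (k : nat -> nat) :
  0 < delta < 1 ->
  k 0%N = 0%N ->
  (forall i, (i < t)%N -> (k i < k i.+1)%N) ->
  (k t < n)%N -> (n <= m)%N ->
  exists A : 'M[R]_(m, n),
    forall i : nat, (1 <= i <= t)%N ->
    forall S : {set 'I_n}, #|S| = k i ->
      Er A S / OPT A (k i) >= (1 - delta) * (k i - k i.-1)%:R.

Proof.
move=> d01 k0 kS ktn nm.
have [e [eK le_e e_le e_eq]] := next_in_range _ _ _ kS ktn.
have [A HA] := block_ratio R m n e delta eK le_e nm d01.
exists A => [[//|i]] /= it S cS.
have kin : (k i.+1 < n)%N.
  apply: leq_ltn_trans ktn; elim: t kS it {e_le e_eq} => // u IHu kS.
  rewrite ltnS leq_eqVlt => /orP[/eqP->//|iu].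
  apply: leq_trans (IHu _ iu) (ltnW (kS _ _)) => // v vu.
  by apply: kS; apply: ltnW.
pose r := Ordinal kin.
have kri : (k i < r)%N by apply: kS.
have er : e r = r by apply/val_inj/e_eq => //; rewrite kri leqnn.
apply: le_trans (HA r er _ S cS); last by move=> j jr; apply: e_le.
apply: ler_wpM2l; first by lra.
rewrite ler_nat.
have lt (x : 'I_(k i.+1 - k i)) : (k i + x.+1 < n)%N.
  by apply: leq_ltn_trans (kin); rewrite -leq_subRL // ltnW.
pose g x := Ordinal (lt x).
have g_inj : injective g by move=> x y [/addnI[xy]]; apply: val_inj.
rewrite -[leqLHS]card_ord -(card_imset _ g_inj) subset_leq_card //.
apply/fintype.subsetP => _ /imsetP[x _ ->]; rewrite inE; apply/eqP/val_inj/e_eq => //=.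
by rewrite -[X in (X < _)%N]addn0 ltn_add2l /= -leq_subRL // ltnW.
Qed.
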